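(* $\mathtt{RealTime_{CA}} = \mathtt{pred}$-$\mathtt{ESO}$-$\mathtt{HORN}$. That is, a language $L\subseteq\Sigma^+$ is accepted in real time by a cellular automaton with parallel input, neighborhood $\{-1,0,1\}$ and the first cell as output cell if and only if $L=\{w\in\Sigma^+ : \langle w\rangle\models\Phi\}$ for some predecessor Horn formula $\Phi$.
   Context: Fix a finite alphabet $\Sigma$. A nonempty word $w=w_1\cdots w_n\in\Sigma^n$ is represented by the first-order structure $\langle w\rangle=([1,n];(Q_s)_{s\in\Sigma},\mathtt{min},\mathtt{max},\mathtt{suc},\mathtt{pred})$ with domain $[1,n]=\{1,\dots,n\}$, where $Q_s(i)\iff w_i=s$, $\mathtt{min}(i)\iff i=1$, $\mathtt{max}(i)\iff i=n$, $\mathtt{suc}(i)=i+1$ for $i<n$, $\mathtt{suc}(n)=n$, $\mathtt{pred}(i)=i-1$ for $i>1$, $\mathtt{pred}(1)=1$. Write $x-k$ for $\mathtt{pred}^k(x)$. A predecessor Horn formula is a formula $\Phi=\exists\mathbf{R}\forall x\forall y\,\psi(x,y)$ where $\mathbf{R}$ is a finite set of binary relation symbols (computation predicates) and $\psi$ is a conjunction of Horn clauses in the variables $x,y$ over the signature $\{(Q_s)_{s\in\Sigma},\mathtt{min},\mathtt{max},\mathtt{suc},\mathtt{pred}\}\cup\mathbf{R}$, each of the form $\delta_1\wedge\cdots\wedge\delta_r\to\delta_0$, where $\delta_0$ is either an atom $R(x,y)$ with $R\in\mathbf{R}$ or $\bot$ (false), and each hypothesis $\delta_i$ is one of: $Q_s(x-a)$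 or $Q_s(y-a)$ ($s\in\Sigma$, integer $a\ge0$); $U(x-a)$, $\neg U(x-a)$, $U(y-a)$, $\neg U(y-a)$ ($U\in\{\mathtt{min},\mathtt{max}\}$, integer $a\ge0$); $S(x-a,y-b)$ or $S(y-b,x-a)$ ($S\in\mathbf{R}$, integers $a,b\ge0$). The formula defines the language $\{w\in\Sigma^+:\langle w\rangle\models\Phi\}$, and $\mathtt{pred}$-$\mathtt{ESO}$-$\mathtt{HORN}$ denotes the class of languages so defined. A cellular automaton is $(Q,\Sigma,Q_{accept},\mathcal{N},\delta)$ with finite state set $Q\supseteq\Sigma$, accepting states $Q_{accept}\subseteq Q$, neighborhood $\mathcal{N}$ a finite ordered subset of $\mathbb{Z}$, and transition function $\delta:Q^{|\mathcal N|}\to Q$. On input $w=w_1\cdots w_n$ it works on cells $1,\dots,n$; cells outside $[1,n]$ are permanently in a special state $\sharp$. Writing $\langle c,t\rangle$ for the state of cell $c$ at time $t$, with parallel input $\langle c,1\rangle=w_c$ and $\langle c,t\rangle=\delta(\langle c+v,t-1\rangle: v\in\mathcal N)$ for $t>1$. $\mathtt{RealTime_{CA}}$ is the class of languages $L\subseteq\Sigma^+$ for which there is such an automaton with parallel input and $\mathcal N=\{-1,0,1\}$ such that for every $w\in\Sigma^+$ of length $n$, $w\in L\iff\langle 1,n\rangle\in Q_{accept}$. *)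

(* Defs.v *)
From mathcomp Require Import all_boot.
From Stdlib Require List.
Set Implicit Arguments. Unset Strict Implicit. Unset Printing Implicit Defensive.

(* A word w = w_1 ... w_n is a seq; letter w_i (1-based) is [onth w i.-1]. *)

Section CA.
Variables (Sigma Q : finType) (inS : Sigma -> Q).
(* transition on neighborhood (-1,0,1); [None] is the border state # *)
Variable delta : option Q -> Q -> option Q -> Q.

(* [ca_state w k c] = <c, k+1>  (None = # when c is outside [1,n]) *)
Fixpoint ca_state (w : seq Sigma) (k c : nat) : option Q :=
  if (0 < c <= size w) then
    match k with
    | 0 => omap inS (onth w c.-1)
    | k'.+1 =>
        if ca_state w k' c is Some q then
          Some (delta (ca_state w k' c.-1) q (ca_state w k' c.+1))
        else None
    end
  else None.

Definition ca_accepts (acc : pred Q) (w : seq Sigma) : Prop :=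
  exists2 q, ca_state w (size w).-1 1 = Some q & acc q.
End CA.

Definition RealTime_CA (Sigma : finType) (L : seq Sigma -> Prop) : Prop :=
  (forall w, L w -> w <> [::]) /\
  exists (Q : finType) (inS : Sigma -> Q) (acc : pred Q)
         (delta : option Q -> Q -> option Q -> Q),
    injective inS /\
    forall w : seq Sigma, w <> [::] -> (L w <-> ca_accepts inS delta acc w).

Inductive hvar := VX | VY.
Inductive usym := Umin | Umax.

(* hypotheses over m computation predicates 'I_m *)
Inductive hyp (Sigma : finType) (m : nat) :=
| HQ of Sigma & hvar & nat                 (* Q_s(v - a) *)
| HU of usym & bool & hvar & nat           (* U(v - a) if true, ~U(v - a) if false *)
| HRxy of 'I_m & nat & nat                 (* S(x - a, y - b) *)
| HRyx of 'I_m & nat & nat.                (* S(y - b, x - a) *)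

(* a Horn clause: hypotheses and conclusion (Some R = R(x,y), None = bottom) *)
Definition clause (Sigma : finType) (m : nat) := (seq (hyp Sigma m) * option 'I_m)%type.

Definition predw (i : nat) : nat := if 1 < i then i.-1 else i.
Definition minus_k (a i : nat) : nat := iter a predw i.

Section Sem.
Variables (Sigma : finType) (m : nat) (w : seq Sigma).
Variable Rint : 'I_m -> nat -> nat -> Prop.
Variables x y : nat.

Definition var_val (v : hvar) : nat := match v with VX => x | VY => y end.

Definition usym_holds (u : usym) (i : nat) : Prop :=
  match u with Umin => i = 1 | Umax => i = size w end.

Definition hyp_holds (h : hyp Sigma m) : Prop :=
  match h with
  | HQ s v a => onth w (minus_k a (var_val v)).-1 = Some s
  | HU u b v a => if b then usym_holds u (minus_k a (var_val v))
                  else ~ usym_holds u (minus_k a (var_val v))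
  | HRxy P a b => Rint P (minus_k a x) (minus_k b y)
  | HRyx P a b => Rint P (minus_k b y) (minus_k a x)
  end.

Definition clause_holds (cl : clause Sigma m) : Prop :=
  (forall h, List.In h cl.1 -> hyp_holds h) ->
  match cl.2 with Some R => Rint R x y | None => False end.
End Sem.

Definition horn_models (Sigma : finType) (m : nat) (cls : seq (clause Sigma m))
  (w : seq Sigma) : Prop :=
  exists Rint : 'I_m -> nat -> nat -> Prop,
    forall x y, 1 <= x <= size w -> 1 <= y <= size w ->
      forall cl, List.In cl cls -> clause_holds w Rint x y cl.

Definition pred_ESO_HORN (Sigma : finType) (L : seq Sigma -> Prop) : Prop :=
  exists (m : nat) (cls : seq (clause Sigma m)),
    forall w, L w <-> (w <> [::] /\ horn_models cls w).

(* Main.v *)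
(* From automata to formulas: in the coordinates x = time, y = cell + time - 1,
   the real-time computation triangle becomes 1 <= x <= y <= n, every transition
   reads sites (x - 1, y - b) with b <= 2, and the output cell is (n, n).

   From formulas to automata: a word satisfies the formula iff its least model
   does not derive a contradiction. Folding the square along its diagonal, cell
   c at time k + 1 stores the part of the least model lying in a window of fixed
   width around the sites (k + 2 - c, c + k) and (c + k, k + 2 - c), once
   assuming that c + k is the last position and once that it is not. This
   state is specified semantically; it is determined by the previous states of
   the three neighbours, so that a transition function exists. *)
Require Import Defs.
From mathcomp Require Import all_boot.
From mathcomp Require Import zify boolp.
From Stdlib Require List.
Set Implicit Arguments. Unset Strict Implicit. Unset Printing Implicit Defensive.

Lemma minus_kE a i : 0 < i -> minus_k a i = maxn 1 (i - a).
Proof.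
move=> i0; rewrite /minus_k; elim: a => [|a IH] /=; first by lia.
by rewrite IH /predw; case: ifP; lia.
Qed.

Lemma List_In_mem (T : eqType) (s : seq T) x : x \in s -> List.In x s.
Proof.
elim: s => //= y s IH; rewrite in_cons => /orP[/eqP->|/IH]; by [left|right].
Qed.

(** As a nested conjunction, the hypotheses of a concrete clause compute and can be destructed by
    patterns. *)
Lemma clause_holdsP (Sigma : finType) m (w : seq Sigma) R x y (cl : clause Sigma m) :
  clause_holds w R x y cl <->
  (foldr (fun h A => hyp_holds w R x y h /\ A) True cl.1 ->
   if cl.2 is Some P then R P x y else False).
Proof.
rewrite /clause_holds; case: cl => hs c /=; split=> H H'; apply: H; last first.
  by elim: hs H' => //= h hs IH H; split; [apply: H; left|apply: IH => *; apply: H; right].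
by elim: hs H' => //= h hs IH [Hh /IH{}IH] h' [<-//|/IH].
Qed.

(** * The Horn formula of an automaton *)

Section AutomatonToHorn.
Variables (Sigma Q : finType) (inS : Sigma -> Q) (acc : pred Q).
Variable delta : option Q -> Q -> option Q -> Q.

Lemma ca_stateS w k c : ca_state inS delta w k.+1 c =
  if (0 < c <= size w) then
    if ca_state inS delta w k c is Some q then
      Some (delta (ca_state inS delta w k c.-1) q (ca_state inS delta w k c.+1))
    else None
  else None.
Proof. by []. Qed.

Lemma ca_state_out w k c : ~~ (0 < c <= size w) -> ca_state inS delta w k c = None.
Proof. by move=> /negbTE h; case: k => [|k] /=; rewrite h. Qed.

Lemma ca_state_in w k c : 0 < c <= size w -> exists q, ca_state inS delta w k c = Some q.
Proof.
move=> h; elim: k => [|k [q Hq]] /=; rewrite h.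
  case E: (onth w c.-1) => [s|]; first by exists (inS s).
  by have := onthTE w c.-1; rewrite E /=; lia.
by rewrite Hq; eexists.
Qed.

(** The signature cannot compare [x] with [y], so two extra predicates, for [x = y] and [x < y], are
    derived by Horn clauses along with the states. *)
Definition site_pred : finType := (Q + bool)%type.
Definition statep (q : Q) : 'I_#|site_pred| := enum_rank (inl q : site_pred).
Definition diagp : 'I_#|site_pred| := enum_rank (inr true : site_pred).
Definition abovep : 'I_#|site_pred| := enum_rank (inr false : site_pred).

Let C := clause Sigma #|site_pred|.
Let minv v : hyp Sigma #|site_pred| := HU _ _ Umin true v 0.
Let nminv v : hyp Sigma #|site_pred| := HU _ _ Umin false v 0.
Let maxv v : hyp Sigma #|site_pred| := HU _ _ Umax true v 0.
Let at_ P a b : hyp Sigma #|site_pred| := HRxy _ P a b.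

Definition order_clauses : seq C :=
  [:: ([:: minv VX; minv VY], Some diagp);
      ([:: nminv VX; nminv VY; at_ diagp 1 1], Some diagp);
      ([:: minv VX; nminv VY], Some abovep);
      ([:: nminv VX; nminv VY; at_ abovep 1 1], Some abovep)].

Definition input_clause (s : Sigma) : C :=
  ([:: minv VX; HQ _ s VY 0], Some (statep (inS s))).

(** Cell 1 is the diagonal: [diagp] stands for a missing left neighbour, [abovep] for a present
    one. *)
Definition step_clause (z : option Q * Q * Q) : C :=
  let: (l, q, r) := z in
  (match l with
   | Some l => [:: at_ abovep 0 0; at_ (statep l) 1 2]
   | None => [:: at_ diagp 0 0] end ++
   [:: nminv VX; at_ (statep q) 1 1; at_ (statep r) 1 0],
   Some (statep (delta l q (Some r)))).

(** For an accepting state the clause is a tautology, which allows indexing by all of [Q]. *)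
Definition reject_clause (q : Q) : C :=
  if acc q then ([:: at_ (statep q) 0 0], Some (statep q))
  else ([:: maxv VX; maxv VY; at_ (statep q) 0 0], None).

Definition ca_clauses : seq C :=
  (order_clauses ++ List.map input_clause (enum Sigma) ++
  List.map step_clause (enum {: option Q * Q * Q}) ++
  List.map reject_clause (enum Q))%list.

Lemma ca_clauses_forall (G : C -> Prop) :
  (forall cl, List.In cl ca_clauses -> G cl) <->
  [/\ forall cl, List.In cl order_clauses -> G cl, forall s, G (input_clause s),
      forall z, G (step_clause z) & forall q, G (reject_clause q)].
Proof.
rewrite /ca_clauses; split.
  move=> H; split=> [cl|s|z|q].
  - by move=> i; apply: H; rewrite !List.in_app_iff; left.
  - apply: H; rewrite !List.in_app_iff; right; left.
    by apply: List.in_map; apply: List_In_mem; rewrite mem_enum.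
  - apply: H; rewrite !List.in_app_iff; right; right; left.
    by apply: List.in_map; apply: List_In_mem; rewrite mem_enum.
  - apply: H; rewrite !List.in_app_iff; right; right; right.
    by apply: List.in_map; apply: List_In_mem; rewrite mem_enum.
move=> [H1 H2 H3 H4] cl; rewrite !List.in_app_iff !List.in_map_iff.
by move=> [/H1|[[s [<- _]]|[[z [<- _]]|[q [<- _]]]]].
Qed.

(* [R(x, y)] speaks about cell [y - x + 1] at time [x]: in these coordinates
   the cells read by the transition are at [(x-1, y-2)], [(x-1, y-1)] and
   [(x-1, y)], and the right border is never read before time [n]. *)
Definition intended w (P : 'I_#|site_pred|) (x y : nat) : Prop :=
  match enum_val P with
  | inl q => x <= y /\ ca_state inS delta w x.-1 (y - x).+1 = Some q
  | inr true => x = y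
  | inr false => x < y
  end.

Lemma intendedE w :
  [/\ forall q x y, intended w (statep q) x y =
        (x <= y /\ ca_state inS delta w x.-1 (y - x).+1 = Some q),
      forall x y, intended w diagp x y = (x = y) &
      forall x y, intended w abovep x y = (x < y)].
Proof. by rewrite /intended /statep /diagp /abovep; split=> *; rewrite enum_rankK. Qed.

Lemma intended_model w : w <> [::] -> ca_accepts inS delta acc w ->
  horn_models ca_clauses w.
Proof.
move=> w0 [qa Ha acca]; exists (intended w) => x y hx hy.
have [Es Ed Ea] := intendedE w.
apply/ca_clauses_forall; split.
- move=> cl /= [|[|[|[|//]]]] <-; apply/clause_holdsP => /=; rewrite ?Ed ?Ea /predw;
    by repeat case: ifP; lia.
- move=> s; apply/clause_holdsP => /=; rewrite Es => -[x1 [ws _]]; split; first lia.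
  by rewrite x1 /= ifT 1?(_ : y - 1 = y.-1) ?ws //; lia.
- move=> [[[l|] q] r]; apply/clause_holdsP; rewrite /= !Es.
  + rewrite Ea => -[xy [[_ hl] [x1 [[_ hq] [[_ hr] _]]]]]; split; first lia.
    move: hr hq hl; rewrite /predw.
    case: x hx x1 xy => [|[|x]] //= hx _ xy; case: y hy xy => [|[|[|y]]] //= hy xy.
    rewrite (_ : y.+3 - x.+2 = (y - x).+1); last by lia.
    rewrite (_ : y.+3 - x.+1 = (y - x).+2); last by lia.
    rewrite (_ : y.+2 - x.+1 = (y - x).+1); last by lia.
    rewrite (_ : y.+1 - x.+1 = y - x); last by lia.
    by move=> hr hq hl; rewrite ifT ?hr ?hq ?hl //; lia.
  + rewrite Ed => -[xy [x1 [[_ hq] [[_ hr] _]]]]; split; first lia.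
    subst y; move: hr hq; rewrite /predw.
    case: x hx {hy} x1 => [|[|x]] //= hx _; rewrite !subnn => hr hq.
    rewrite ifT ?hq; last by lia.
    by rewrite (_ : x.+2 - x.+1 = 1) in hr; [rewrite hr ca_state_out|lia].
- move=> q; apply/clause_holdsP; rewrite /reject_clause; case: ifP => aq /=.
    by case.
  rewrite Es => -[xn [yn [[_ h] _]]]; move: acca.
  by move: h; rewrite xn yn subnn Ha => -[->]; rewrite aq.
Qed.

(** Induction on the time [x], once the order facts are derived. Every model thus contains the whole
    computation, including a rejecting state at the output site. *)
Lemma model_intended w R :
  (forall x y, 1 <= x <= size w -> 1 <= y <= size w ->
     forall cl, List.In cl ca_clauses -> clause_holds w R x y cl) ->
  forall x y q, 0 < x -> x <= y <= size w ->
  ca_state inS delta w x.-1 (y - x).+1 = Some q -> R (statep q) x y.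
Proof.
move=> HR.
have {}HR x y : 1 <= x <= size w -> 1 <= y <= size w -> _ :=
  fun hx hy => (ca_clauses_forall _).1 (HR x y hx hy).
have Hd x : 0 < x <= size w -> R diagp x x.
  elim: x => [//|[|x] IH] h; have [Ho _ _ _] := HR _ _ h h.
    by move/clause_holdsP: (Ho _ (or_introl erefl)); apply=> /=.
  move/clause_holdsP: (Ho _ (or_intror (or_introl erefl))); apply=> /=.
  by do 3 split=> //; apply: IH; lia.
have Ha x y : 0 < x -> x < y <= size w -> R abovep x y.
  elim: x y => [//|[|x] IH] [//|y] h0 h1; have hy : 1 <= y.+1 <= size w by lia.
    have [Ho _ _ _] := HR 1 _ ltac:(lia) hy.
    move/clause_holdsP: (Ho _ (or_intror (or_intror (or_introl erefl)))); apply=> /=.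
    by do 2 split=> //; lia.
  have [Ho _ _ _] := HR x.+2 _ ltac:(lia) hy.
  move/clause_holdsP: (Ho _ (or_intror (or_intror (or_intror (or_introl erefl))))); apply=> /=.
  split=> //; split; first by lia.
  by case: y h1 {hy Ho} => [|y] h1; [lia|split=> //=; apply: (IH y.+1); lia].
elim=> [//|[|x] IH] y q _ xy.
  have [_ Hi _ _] := HR 1 y ltac:(lia) ltac:(lia).
  rewrite /= ifT; last by lia.
  case E: (onth w _) => [s|//] [<-].
  move/clause_holdsP: (Hi s); apply=> /=; do 2 split=> //.
  by rewrite -E; congr onth; lia.
have [_ _ Hs _] := HR x.+2 y ltac:(lia) ltac:(lia).
rewrite [x.+2.-1]/= ca_stateS ifT; last by lia.
have [r Hr] : exists r, ca_state inS delta w x (y - x.+2).+2 = Some r.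
  by apply: ca_state_in; lia.
rewrite [(y - _).+1.-1]/= Hr; case Hq: (ca_state _ _ _ _ (y - x.+2).+1) => [q2|//].
case: y xy Hs Hr Hq => [|[|y]] // xy Hs Hr Hq.
have HRq : R (statep q2) x.+1 y.+1.
  by apply: (IH y.+1); [|lia|rewrite -Hq; congr (ca_state _ _ _ _); lia].
have HRr : R (statep r) x.+1 y.+2.
  by apply: (IH y.+2); [|lia|rewrite -Hr; congr (ca_state _ _ _ _); lia].
case El: (ca_state _ _ _ _ _) => [l|] [<-].
  move/clause_holdsP: (Hs (Some l, q2, r)); apply=> /=.
  have lt_xy : x < y by rewrite ltnNge; apply/negP => yx; move: El; rewrite ca_state_out //; lia.
  case: y El lt_xy xy HRq HRr {Hs Hr Hq} => [//|y] El lt_xy xy HRq HRr.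
  split; first by apply: Ha; lia.
  split; first by apply: (IH y.+1); [|lia|rewrite -El; congr (ca_state _ _ _ _); lia].
  by [].
(* Without a left neighbour the cell is the first one, so the site is on the diagonal. *)
have e : x = y.
  case: (ltngtP x y) => // lt_xy; last by lia.
  by have [|? e] := @ca_state_in w x (y.+2 - x.+2); [lia|rewrite e in El].
subst y; move/clause_holdsP: (Hs (None, q2, r)); apply=> /=.
by split=> //; apply: Hd; lia.
Qed.

Lemma ca_horn w : w <> [::] ->
  (ca_accepts inS delta acc w <-> horn_models ca_clauses w).
Proof.
move=> w0; split; first exact: intended_model.
have n0 : 0 < size w by case: w w0.
move=> [R HR]; have [q Hq] := @ca_state_in w (size w).-1 1 ltac:(lia).
exists q => //; apply/negPn/negP => aq.
have Rq : R (statep q) (size w) (size w).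
  by apply: (model_intended HR) => //; [lia|rewrite subnn].
have /ca_clauses_forall[_ _ _ /(_ q)] := HR (size w) (size w) ltac:(lia) ltac:(lia).
by move/clause_holdsP; rewrite /reject_clause (negbTE aq); apply.
Qed.
End AutomatonToHorn.

(** * The least model of a Horn formula *)

Section HornToAutomaton.
Variables (Sigma : finType) (m : nat) (cls : seq (clause Sigma m)).

Definition letter (w : seq Sigma) i := onth w i.-1.

(* The maximum is a parameter [N] rather than [size w]: the automaton works
   both with the prefixes of its input, and with an input of unknown length
   ([N = 0]). *)
Definition hyp_ok (w : seq Sigma) N (R : option 'I_m -> nat -> nat -> Prop) x y
    (h : hyp Sigma m) : Prop :=
  match h with
  | HQ s v a => letter w (minus_k a (var_val x y v)) = Some s
  | HU u b v a =>
      let U := minus_k a (var_val x y v) = (if u is Umin then 1 else N) in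
      if b then U else ~ U
  | HRxy P a b => R (Some P) (minus_k a x) (minus_k b y)
  | HRyx P a b => R (Some P) (minus_k b y) (minus_k a x)
  end.

Definition closed w N (R : option 'I_m -> nat -> nat -> Prop) : Prop :=
  forall x y, 0 < x -> 0 < y ->
    (forall cl, List.In cl cls ->
       (forall h, List.In h cl.1 -> hyp_ok w N R x y h) -> R cl.2 x y) /\
    (forall a b, a <= 1 -> b <= 1 ->
       R None (minus_k a x) (minus_k b y) -> R None x y).

(* [None] stands for [false], and is propagated to the sites above and to the
   right, so that the site (n, n) knows about all contradictions. *)
Definition least w N P x y : Prop := forall R, closed w N R -> R P x y.

Lemma hyp_ok_mono w N (R R' : option 'I_m -> nat -> nat -> Prop) x y h :
  (forall P u v, R P u v -> R' P u v) -> hyp_ok w N R x y h -> hyp_ok w N R' x y h.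
Proof. by move=> RR'; case: h => //= *; apply: RR'. Qed.

Lemma least_closed w N : closed w N (least w N).
Proof.
move=> x y x0 y0; split=> [cl hcl H R cR|a b a1 b1 H R cR].
  apply: (cR x y x0 y0).1 => // h /H; apply: hyp_ok_mono => P u v; exact.
exact: (cR x y x0 y0).2 a1 b1 (H _ cR).
Qed.

(** Pairing [G] with [least] keeps the derivability of the premises available in the induction
    step. *)
Lemma least_ind w N (G : option 'I_m -> nat -> nat -> Prop) :
  closed w N (fun P x y => least w N P x y /\ G P x y) ->
  forall P x y, least w N P x y -> G P x y.
Proof. by move=> cG P x y /(_ _ cG)[]. Qed.

Lemma leastS w N x y x' y' : 0 < x -> 0 < y -> x <= x' -> y <= y' ->
  least w N None x y -> least w N None x' y'.
Proof.
move=> x0 y0 /subnK <- /subnK <- H.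
elim: (x' - x) => [|d IH]; last first.
  have [_ /(_ 1 0 isT isT)] := @least_closed w N (d.+1 + x) (y' - y + y) ltac:(lia) ltac:(lia).
  by apply; rewrite /minus_k /= /predw ifT //; lia.
elim: (y' - y) => [//|d IH].
have [_ /(_ 0 1 isT isT)] := @least_closed w N (0 + x) (d.+1 + y) ltac:(lia) ltac:(lia).
by apply; rewrite /minus_k /= /predw ifT //; lia.
Qed.

(** A model, extended by all facts outside the square and by no contradiction inside it, is closed.
    Conversely, a contradiction derived in the square would propagate to its last corner. *)
Lemma horn_models_least w : w <> [::] ->
  (horn_models cls w <-> ~ least w (size w) None (size w) (size w)).
Proof.
move=> w0; have n0 : 0 < size w by case: w w0.
split=> [[R HR] H|H].
  pose R' P x y := x <= size w -> y <= size w ->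
     if P is Some P' then R P' x y else False.
  suff /H : closed w (size w) R' by apply.
  move=> x y x0 y0; split=> [cl hcl Hh xn yn|a b _ _ Hr xn yn]; last first.
    by apply: Hr; rewrite minus_kE //; lia.
  have := HR x y ltac:(lia) ltac:(lia) cl hcl.
  rewrite /clause_holds; case: (cl.2) => [P|]; apply=> h /Hh.
    case: h => //= [[] [] //|P' a b|P' a b]; apply; rewrite minus_kE //; lia.
  case: h => //= [[] [] //|P' a b|P' a b]; apply; rewrite minus_kE //; lia.
exists (fun P => least w (size w) (Some P)) => x y hx hy cl hcl Hh.
have [/(_ cl hcl) C _] := @least_closed w (size w) x y ltac:(lia) ltac:(lia).
have : least w (size w) cl.2 x y.
  by apply: C => h /Hh; case: h => //= [[]].
case: (cl.2) => // Hn; apply: H; apply: leastS Hn; lia.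
Qed.

(** * Locality of derivations *)

Definition hyp_radius (h : hyp Sigma m) : nat :=
  match h with
  | HQ _ _ a => a | HU _ _ _ a => a
  | HRxy _ a b => maxn a b | HRyx _ a b => maxn a b
  end.

Definition list_max T (f : T -> nat) (s : seq T) :=
  foldr (fun x => maxn (f x)) 0 s.

Lemma list_max_ge T (f : T -> nat) s x : List.In x s -> f x <= list_max f s.
Proof.
by elim: s => //= y s IH [->|/IH]; lia.
Qed.

(** At least 1, to cover the propagation of contradictions from adjacent sites. *)
Definition radius := maxn 1 (list_max (fun cl : clause Sigma m => list_max hyp_radius cl.1) cls).

Lemma radiusP cl h : List.In cl cls -> List.In h cl.1 -> hyp_radius h <= radius.
Proof.
move=> hcl hh; rewrite /radius leq_max; apply/orP; right.
apply: leq_trans (list_max_ge _ hcl) => /=; exact: list_max_ge.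
Qed.

Lemma radius_gt0 : 0 < radius. Proof. by rewrite /radius leq_max. Qed.

Definition alike w N w' N' u u' := [/\ 0 < u, 0 < u' &
  forall k, k <= radius ->
    [/\ letter w (minus_k k u) = letter w' (minus_k k u'),
        minus_k k u = 1 <-> minus_k k u' = 1 &
        minus_k k u = N <-> minus_k k u' = N']].

(** A simulation, by induction on derivations: related sites either transfer all facts already, or
    admit the same clause instances, whose premises lie at related sites. Both orders of the
    coordinates occur because of hypotheses [S(y - b, x - a)]. *)
Lemma least_sim w N w' N' (E : nat -> nat -> nat -> nat -> Prop) :
  (forall u v u' v', E u v u' v' ->
     (forall P, least w N P u v -> least w' N' P u' v') \/
     [/\ alike w N w' N' u u', alike w N w' N' v v' &
      forall k l, k <= radius -> l <= radius ->
        E (minus_k k u) (minus_k l v) (minus_k k u') (minus_k l v') /\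
        E (minus_k l v) (minus_k k u) (minus_k l v') (minus_k k u')]) ->
  forall P u v u' v', E u v u' v' -> least w N P u v -> least w' N' P u' v'.
Proof.
move=> HE P u v u' v' Euv H; move: H u' v' Euv.
apply: (@least_ind w N (fun P u v => forall u' v', E u v u' v' -> least w' N' P u' v')).
move=> {P u v} x y x0 y0; have [C1 C2] := @least_closed w N _ _ x0 y0.
split=> [cl hcl Hh|a b a1 b1 [Hn IH]].
  have Hl : least w N cl.2 x y.
    by apply: C1 => // h /Hh; apply: hyp_ok_mono => P u v [].
  split=> // x' y' /HE[/(_ _ Hl)//|[[_ x'0 ax] [_ y'0 ay] Eh]].
  have [C1' _] := @least_closed w' N' _ _ x'0 y'0.
  apply: C1' => // h hh; have := Hh h hh; have := radiusP hcl hh.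
  case: h {hh} => [s v a|u b v a|P a b|P a b] /= ha.
  - by case: v => /=; [case: (ax a ha)|case: (ay a ha)] => ->.
  - by case: v => /=; [case: (ax a ha)|case: (ay a ha)] => _ [? ?] [? ?];
      case: u; case: b; tauto.
  - case=> _; apply; apply: (Eh a b _ _).1; lia.
  - case=> _; apply; apply: (Eh a b _ _).2; lia.
have Hl : least w N None x y by apply: C2 Hn.
split=> // x' y' /HE[/(_ _ Hl)//|[[_ x'0 ax] [_ y'0 ay] Eh]].
have [_ C2'] := @least_closed w' N' _ _ x'0 y'0.
have r0 := radius_gt0; apply: (C2' a b) => //; apply: IH; apply: (Eh a b _ _).1; lia.
Qed.

(** Clauses only look backwards, so derivations below [N] never meet the maximum; nor does any
    positive position equal 0. *)
Lemma least_below w N P u v : 0 < u < N -> 0 < v < N ->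
  (least w N P u v <-> least w 0 P u v).
Proof.
move=> hu hv.
pose E u v u' v' := [/\ u = u', v = v', 0 < u < N & 0 < v < N].
have alikeN x : 0 < x < N -> alike w N w 0 x x /\ alike w 0 w N x x.
  by move=> hx; split; split; try lia; move=> k _; rewrite minus_kE; try lia;
    split=> //; split; lia.
have EN u' v' : 0 < u' < N -> 0 < v' < N ->
    forall k l, k <= radius -> l <= radius ->
      E (minus_k k u') (minus_k l v') (minus_k k u') (minus_k l v') /\
      E (minus_k l v') (minus_k k u') (minus_k l v') (minus_k k u').
  by move=> h1 h2 k l _ _; rewrite !minus_kE; try lia; split; split=> //; lia.
by split; apply: (@least_sim _ _ _ _ E) => // u' v' _ _ [<- <- h1 h2]; right; split;
  try exact: EN; [case: (alikeN _ h1)|case: (alikeN _ h2)|case: (alikeN _ h1)|case: (alikeN _ h2)].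
Qed.

(* Cell [c] at time [k + 1] is in charge of the site (k + 2 - c, c + k), once
   c <= k: a cell cannot know that it is the c-th one earlier. *)
Definition pos k c (s : bool) a := maxn 1 ((if s then c + k else k.+2 - c) - a).

(** [md] is the assumption that [c + k] is the last position; the value 0 makes [max] false at all
    sites. *)
Definition bound k c (md : bool) := if md then c + k else 0.

(** Clauses are replayed only at offsets up to 2, from which they reach back by at most [radius]. *)
Definition width := radius.+2.

Definition similar w k c w' k' c' := [/\ letter w (c + k) = letter w' (c' + k'),
  (c <= k) = (c' <= k'),
  c <= k -> forall s a, a <= width ->
    letter w (pos k c s a) = letter w' (pos k' c' s a) /\
    (pos k c s a == 1) = (pos k' c' s a == 1) &
  c <= k -> forall md P s a b, a <= width -> b <= width ->
    least w (bound k c md) P (pos k c s a) (pos k c (~~ s) b) <->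
    least w' (bound k' c' md) P (pos k' c' s a) (pos k' c' (~~ s) b)].

Lemma similar_sym w k c w' k' c' : similar w k c w' k' c' -> similar w' k' c' w k c.
Proof.
move=> [H1 H2 H3 H4]; split=> // [h s a ha|h md P s a b ha hb].
  by have [|-> ->] := H3 _ s a ha; rewrite ?H2.
by symmetry; apply: H4 => //; rewrite H2.
Qed.

(** * Windows are determined by those of the three neighbours *)

Lemma pos_gt0 k c s a : 0 < pos k c s a. Proof. by rewrite /pos; lia. Qed.

Lemma minus_pos k c s a d : minus_k d (pos k c s a) = pos k c s (a + d).
Proof. by rewrite minus_kE /pos; lia. Qed.

Lemma least_bound w k c (md : bool) P u v : 0 < u -> 0 < v -> (md -> u < c + k /\ v < c + k) ->
  (least w (bound k c md) P u v <-> least w 0 P u v).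
Proof. by case: md => //= u0 v0 /(_ isT)[hu hv]; apply: least_below; lia. Qed.

(** A cell is active at the next time iff it is the first one or its left neighbour is active
    now. *)
Lemma active_step w k c w' k' c' : 0 < c -> 0 < c' -> (c == 1) = (c' == 1) ->
  (c != 1 -> similar w k c.-1 w' k' c'.-1) -> (c <= k.+1) = (c' <= k'.+1).
Proof.
move=> c0 c'0 e H; have [c1|c1] := eqVneq c 1; first by move: e; rewrite c1; lia.
by have [_ h _ _] := H c1; move: e h; lia.
Qed.

(** The newest letter comes from the right neighbour, the other letters on the [true] side from the
    cell itself or, on activation, from its left neighbour. The [false] side is that of the left
    neighbour; for [c = 1] both sides coincide. *)
Lemma letters_step w k c w' k' c' : 0 < c -> 0 < c' -> (c == 1) = (c' == 1) ->
  (c != 1 -> similar w k c.-1 w' k' c'.-1) ->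
  similar w k c w' k' c' -> similar w k c.+1 w' k' c'.+1 ->
  c <= k.+1 -> c' <= k'.+1 -> forall s a, a <= width ->
    letter w (pos k.+1 c s a) = letter w' (pos k'.+1 c' s a) /\
    (pos k.+1 c s a == 1) = (pos k'.+1 c' s a == 1).
Proof.
move=> c0 c'0 e HL [M1 M2 M3 _] [R1 _ _ _] hk hk'.
(* Both coordinates of the site of a cell grow by one per step, so offset [a] was offset [a - 1]. *)
have HM s a : 0 < a -> a <= width -> c <= k ->
    letter w (pos k.+1 c s a) = letter w' (pos k'.+1 c' s a) /\
    (pos k.+1 c s a == 1) = (pos k'.+1 c' s a == 1).
  move=> a0 ha ck; have := M3 ck s a.-1 ltac:(lia); rewrite /pos.
  have -> : (if s then c + k.+1 else k.+3 - c) - a = (if s then c + k else k.+2 - c) - a.-1.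
    by case: s; lia.
  by have -> : (if s then c' + k'.+1 else k'.+3 - c') - a = (if s then c' + k' else k'.+2 - c') - a.-1
    by case: s; lia.
have HY a : a <= width ->
    letter w (pos k.+1 c true a) = letter w' (pos k'.+1 c' true a) /\
    (pos k.+1 c true a == 1) = (pos k'.+1 c' true a == 1).
  case: (ltnP 0 a) => [a0|a0] ha; last first.
    rewrite /pos (_ : maxn 1 (c + k.+1 - a) = c.+1 + k); last by lia.
    by rewrite (_ : maxn 1 (c' + k'.+1 - a) = c'.+1 + k') ?R1; [split=> //; lia|lia].
  case: (leqP c k) => ck; first exact: HM.
  have [a1|a1] := boolP ((a == 1) || (c == 1)).
    rewrite /pos (_ : maxn 1 (c + k.+1 - a) = c + k); last by lia.
    by rewrite (_ : maxn 1 (c' + k'.+1 - a) = c' + k') ?M1; [split=> //; lia|lia].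
  have [_ _ L3 _] := HL ltac:(lia).
  have := L3 ltac:(lia) true (a - 2) ltac:(lia).
  rewrite /pos (_ : c.-1 + k - (a - 2) = c + k.+1 - a); last by lia.
  by rewrite (_ : c'.-1 + k' - (a - 2) = c' + k'.+1 - a); last by lia.
move=> [] a ha; first exact: HY.
have [c1|c1] := eqVneq c 1.
  have := HY a ha; rewrite /pos (_ : k.+3 - c = c + k.+1); last by lia.
  by rewrite (_ : k'.+3 - c' = c' + k'.+1); last by lia.
have [_ _ L3 _] := HL c1.
have := L3 ltac:(lia) false a ha.
rewrite /pos (_ : k.+2 - c.-1 = k.+3 - c); last by lia.
by rewrite (_ : k'.+2 - c'.-1 = k'.+3 - c'); last by lia.
Qed.

(* Either the facts at window offset (a, b) are already stored by one of the
   three neighbours, or the offset may be replaced by one close to the corner,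
   so that all hypotheses of a clause at that site are still in the window. *)
Lemma facts_step w k c w' k' c' : 0 < c -> 0 < c' -> (c == 1) = (c' == 1) ->
  (c != 1 -> similar w k c.-1 w' k' c'.-1) ->
  similar w k c w' k' c' -> similar w k c.+1 w' k' c'.+1 ->
  c <= k.+1 -> c' <= k'.+1 -> forall md a b, a <= width -> b <= width ->
  (forall s P,
    least w (bound k.+1 c md) P (pos k.+1 c s (if s then b else a))
                                (pos k.+1 c (~~ s) (if s then a else b)) ->
    least w' (bound k'.+1 c' md) P (pos k'.+1 c' s (if s then b else a))
                                (pos k'.+1 c' (~~ s) (if s then a else b))) \/
  exists a0 b0, [/\ a0 <= 2, b0 <= 2,
    pos k.+1 c false a = pos k.+1 c false a0 /\ pos k'.+1 c' false a = pos k'.+1 c' false a0 &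
    pos k.+1 c true b = pos k.+1 c true b0 /\ pos k'.+1 c' true b = pos k'.+1 c' true b0].
Proof.
move=> c0 c'0 e HL HM HR hk hk' md a b ha hb.
have [_ M2 _ M4] := HM; have [_ R2 _ R4] := HR.
(* through a neighbour whose facts do not depend on the maximum *)
have via_below z z' az bz :
    similar w k z w' k' z' -> z <= k -> az <= width -> bz <= width ->
    pos k z false az = pos k.+1 c false a -> pos k' z' false az = pos k'.+1 c' false a ->
    pos k z true bz = pos k.+1 c true b -> pos k' z' true bz = pos k'.+1 c' true b ->
    pos k.+1 c false a < c + k.+1 -> pos k.+1 c true b < c + k.+1 ->
    pos k'.+1 c' false a < c' + k'.+1 -> pos k'.+1 c' true b < c' + k'.+1 ->
    forall s P,
    least w (bound k.+1 c md) P (pos k.+1 c s (if s then b else a))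
                                (pos k.+1 c (~~ s) (if s then a else b)) ->
    least w' (bound k'.+1 c' md) P (pos k'.+1 c' s (if s then b else a))
                                (pos k'.+1 c' (~~ s) (if s then a else b)).
  move=> [_ _ _ Z4] zk haz hbz e1 e2 e3 e4 l1 l2 l3 l4 s P.
  rewrite least_bound ?pos_gt0 //; last by case: s.
  rewrite least_bound ?pos_gt0 //; last by case: s.
  case: s => /=; rewrite -?e1 -?e2 -?e3 -?e4 => H.
    exact: (Z4 zk false P true _ _ hbz haz).1.
  exact: (Z4 zk false P false _ _ haz hbz).1.
(* A newly active cell has [c = k + 1] and first coordinate 2, so [a] matters only up to 1. *)
case: (leqP c k) => ck; last first.
  have ck' : k' < c' by rewrite ltnNge -M2; lia.
  have [c1|c1] := eqVneq c 1.
    by right; exists (minn a 1), (minn b 1); rewrite /pos; split; lia.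
  case: (leqP b 1) => b1.
    by right; exists (minn a 1), b; rewrite /pos; split; lia.
  by left; apply: (via_below c.-1 c'.-1 a (b - 2) (HL c1)); rewrite /pos; lia.
have ck' : c' <= k' by rewrite -M2.
case: (boolP ((0 < a) && (0 < b))) => [/andP[a0 b0]|ab0].
  by left; apply: (via_below c c' a.-1 b.-1 HM); rewrite /pos; lia.
(* For [b = 0] the right neighbour has the same second coordinate and a first one smaller by 2. It
   also has the same candidate maximum, so both values of [md] transfer. *)
case: (leqP a 2) => a2; last first.
  have b0 : b = 0 by lia.
  case: (leqP c.+1 k) => ck1; last first.
    have ck1' : k' < c'.+1 by rewrite ltnNge -R2; lia.
    by right; exists 2, b; rewrite /pos; split; lia.
  have ck1' : c' < k' by rewrite -R2.
  left=> s P.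
  have -> : bound k.+1 c md = bound k c.+1 md by rewrite /bound addSnnS.
  have -> : bound k'.+1 c' md = bound k' c'.+1 md by rewrite /bound addSnnS.
  have := (R4 ck1 md P s (if s then b else a - 2) (if s then a - 2 else b)
     ltac:(case: s; lia) ltac:(case: s; lia)).1.
  by case: s => /=; rewrite /pos; congr (least _ _ _ _ _ -> least _ _ _ _ _); lia.
case: (leqP b 2) => b2; first by right; exists a, b.
have a0 : a = 0 by lia.
have [c1|c1] := eqVneq c 1; last first.
  by left; apply: (via_below c.-1 c'.-1 a (b - 2) (HL c1)); rewrite /pos; lia.
case: (leqP c.+1 k) => ck1; last first.
  have ck1' : k' < c'.+1 by rewrite ltnNge -R2; lia.
  by right; exists a, 2; rewrite /pos; split; lia.
have ck1' : c' < k' by rewrite -R2.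
have c'1 : c' = 1 by lia.
left=> s P.
have -> : bound k.+1 c md = bound k c.+1 md by rewrite /bound addSnnS.
have -> : bound k'.+1 c' md = bound k' c'.+1 md by rewrite /bound addSnnS.
(* on the diagonal, [x = y] and the right neighbour is used transposed *)
have := (R4 ck1 md P (~~ s) (if s then b - 2 else a) (if s then a else b - 2)
   ltac:(case: s; lia) ltac:(case: s; lia)).1.
by case: s => /=; rewrite /pos; congr (least _ _ _ _ _ -> least _ _ _ _ _); lia.
Qed.

Lemma least_step w k c w' k' c' : 0 < c -> 0 < c' -> (c == 1) = (c' == 1) ->
  (c != 1 -> similar w k c.-1 w' k' c'.-1) ->
  similar w k c w' k' c' -> similar w k c.+1 w' k' c'.+1 ->
  c <= k.+1 -> c' <= k'.+1 -> forall md P s a b, a <= width -> b <= width ->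
    least w (bound k.+1 c md) P (pos k.+1 c s a) (pos k.+1 c (~~ s) b) ->
    least w' (bound k'.+1 c' md) P (pos k'.+1 c' s a) (pos k'.+1 c' (~~ s) b).
Proof.
move=> c0 c'0 e HL HM HR hk hk' md P s a b ha hb.
pose E u v u' v' := exists s a b, [/\ a <= width, b <= width,
  u = pos k.+1 c s a /\ u' = pos k'.+1 c' s a &
  v = pos k.+1 c (~~ s) b /\ v' = pos k'.+1 c' (~~ s) b].
apply: (@least_sim _ _ _ _ E); last by exists s, a, b.
move=> {P s a b ha hb} u v u' v' [s [a [b [ha hb [-> ->] [-> ->]]]]].
have HA t d : d <= 2 -> alike w (bound k.+1 c md) w' (bound k'.+1 c' md)
    (pos k.+1 c t d) (pos k'.+1 c' t d).
  move=> d2; split; rewrite ?pos_gt0 // => i hi; rewrite !minus_pos.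
  have [h1 h2] := letters_step c0 c'0 e HL HM HR hk hk' t (a := d + i) ltac:(rewrite /width; lia).
  split=> //; first by split=> /eqP h; apply/eqP; [rewrite -h2|rewrite h2].
  (* The maximum [c + k + 1] is met only at offset 0: on the [true] side, and also on the [false]
     side iff [c = 1]. *)
  by rewrite /bound /pos; case: (md); case: t {h1 h2}; split; lia.
suff [|[a0 [b0 [a02 b02 [-> ->] [-> ->]]]]] :
  (forall P, least w (bound k.+1 c md) P (pos k.+1 c s a) (pos k.+1 c (~~ s) b) ->
    least w' (bound k'.+1 c' md) P (pos k'.+1 c' s a) (pos k'.+1 c' (~~ s) b)) \/
  exists a0 b0, [/\ a0 <= 2, b0 <= 2,
    pos k.+1 c s a = pos k.+1 c s a0 /\ pos k'.+1 c' s a = pos k'.+1 c' s a0 &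
    pos k.+1 c (~~ s) b = pos k.+1 c (~~ s) b0 /\
    pos k'.+1 c' (~~ s) b = pos k'.+1 c' (~~ s) b0].
- by left.
- right; split; try exact: HA; move=> i j hi hj; rewrite !minus_pos; split.
    by exists s, (a0 + i), (b0 + j); rewrite /width; split=> //; lia.
  by exists (~~ s), (b0 + j), (a0 + i); rewrite negbK /width; split=> //; lia.
case: s.
  case: (facts_step c0 c'0 e HL HM HR hk hk' md hb ha) => [/(_ true)|]; first by left.
  by move=> [b0 [a0 [? ? ? ?]]]; right; exists a0, b0.
case: (facts_step c0 c'0 e HL HM HR hk hk' md ha hb) => [/(_ false)|]; first by left.
by move=> [a0 [b0 [? ? ? ?]]]; right; exists a0, b0.
Qed.

(** This is the determinism behind the transition function; by symmetry, one direction of transfer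
    suffices. *)
Lemma similar_step w k c w' k' c' : 0 < c -> 0 < c' -> (c == 1) = (c' == 1) ->
  (c != 1 -> similar w k c.-1 w' k' c'.-1) ->
  similar w k c w' k' c' -> similar w k c.+1 w' k' c'.+1 ->
  similar w k.+1 c w' k'.+1 c'.
Proof.
move=> c0 c'0 e HL HM HR; have hk := active_step c0 c'0 e HL.
split=> //.
- by have [h _ _ _] := HR; rewrite -!addSnnS.
- by move=> ck; apply: letters_step => //; rewrite -hk.
move=> ck md P s a b ha hb; split; apply: least_step => //; rewrite -?hk //.
- by move=> c1; apply/similar_sym/HL; rewrite e.
- exact: similar_sym.
- exact: similar_sym.
Qed.

(** * The automaton of a Horn formula *)

Definition window : finType :=
  ({ffun bool * 'I_width.+1 -> option Sigma * bool} *
   {ffun bool * option 'I_m * bool * 'I_width.+1 * 'I_width.+1 -> bool})%type.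

Definition state : finType := (option Sigma * option window)%type.

Definition state_at w k c : state :=
  (letter w (c + k),
   if c <= k then Some
     ([ffun z : bool * 'I_width.+1 =>
         (letter w (pos k c z.1 z.2), pos k c z.1 z.2 == 1)],
      [ffun z : bool * option 'I_m * bool * 'I_width.+1 * 'I_width.+1 =>
         let: (md, P, s, a, b) := z in
         `[< least w (bound k c md) P (pos k c s a) (pos k c (~~ s) b) >]])
   else None).

Lemma state_atP w k c w' k' c' :
  state_at w k c = state_at w' k' c' <-> similar w k c w' k' c'.
Proof.
split; last first.
  move=> [H1 H2 H3 H4]; rewrite /state_at H1 H2; case: ifP => // h; rewrite H2 h in H3 H4.
  congr (_, Some (_, _)); apply/ffunP.
    by move=> [s a]; rewrite !ffunE /=; have [|-> ->] := H3 isT s a; rewrite // -ltnS.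
  move=> [[[[md P] s] a] b]; rewrite !ffunE; apply: asbool_equiv_eq.
  by apply: H4; rewrite // -ltnS.
rewrite /state_at => -[H1 H2]; split=> //.
- by move: H2; case: (c <= k); case: (c' <= k').
- move=> ck s a ha; move: H2; rewrite ck; case: ifP => // _ [/ffunP H2 _].
  by have := H2 (s, Ordinal (ha : a < width.+1)); rewrite !ffunE /= => -[-> ->].
- move=> ck md P s a b ha hb; move: H2; rewrite ck; case: ifP => // _ [_ /ffunP H2].
  have := H2 (md, P, s, Ordinal (ha : a < width.+1), Ordinal (hb : b < width.+1)).
  by rewrite ffunE [RHS]ffunE => h; apply: asbool_eq_equiv.
Qed.

Definition horn_input (s : Sigma) : state := (Some s, None).

Definition left_state w k c : option state :=
  if c == 1 then None else Some (state_at w k c.-1).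

(** Any word, time and cell realizing the neighbourhood may be chosen, since [similar_step] makes
    the result independent of the choice. Unrealized neighbourhoods get the default [q]. *)
Definition horn_delta (l : option state) (q : state) (r : option state) : state :=
  match pselect (exists z : seq Sigma * nat * nat, let: (w, k, c) := z in
     [/\ 0 < c, l = left_state w k c, q = state_at w k c & r = Some (state_at w k c.+1)]) with
  | left H => let: (w, k, c) := projT1 (cid H) in state_at w k.+1 c
  | right _ => q
  end.

Lemma horn_deltaE w k c : 0 < c ->
  horn_delta (left_state w k c) (state_at w k c) (Some (state_at w k c.+1)) =
  state_at w k.+1 c.
Proof.
move=> c0; rewrite /horn_delta; case: pselect => [H|[]]; last by exists (w, k, c).
case: cid => -[[w' k'] c'] /= [c'0 HL /state_atP HM /Some_inj/state_atP HR].
apply/state_atP/similar_sym; apply: similar_step => //.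
  by move: HL; rewrite /left_state; case: (c == 1); case: (c' == 1).
by move=> c1; apply/state_atP; move: HL; rewrite /left_state (negbTE c1); case: (c' == 1) => // /Some_inj.
Qed.

(** The bound [c + k <= size w] keeps the computation away from the right border, and it holds for
    the output cell. *)
Lemma horn_run w k c : 0 < c -> c + k <= size w ->
  ca_state horn_input horn_delta w k c = Some (state_at w k c).
Proof.
elim: k c => [|k IH] c c0 hc.
  rewrite /= ifT; last by lia.
  have : onth w c.-1 by rewrite onthTE; lia.
  rewrite /state_at /letter addn0 ifF; last by lia.
  by case: (onth w c.-1).
rewrite ca_stateS ifT; last by lia.
rewrite (IH c) // ?(IH c.+1) //; try lia.
rewrite -horn_deltaE //; congr (Some (horn_delta _ _ _)).
rewrite /left_state; case: eqVneq => [->|c1]; first by rewrite ca_state_out.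
by rewrite IH //; lia.
Qed.

(** At the output, the entry read is a contradiction at the site (n, n), with n taken as the
    maximum. A one-letter word ends before its cell has a window, so it is decided directly. *)
Definition horn_acc (q : state) : bool :=
  match q with
  | (_, Some (_, facts)) => ~~ facts (true, None, false, ord0, ord0)
  | (Some s, None) => `[< horn_models cls [:: s] >]
  | (None, None) => false
  end.

Lemma horn_ca w : w <> [::] ->
  (horn_models cls w <-> ca_accepts horn_input horn_delta horn_acc w).
Proof.
move=> w0; have n0 : 0 < size w by case: w w0.
have Hr := @horn_run w (size w).-1 1 isT ltac:(lia).
suff <- : horn_acc (state_at w (size w).-1 1) <-> horn_models cls w.
  split=> [h|[q]]; first by eexists; eauto.
  by rewrite Hr => -[<-].
case: w {Hr} w0 n0 => [//|s [|s' w]] w0 _; first by rewrite /horn_acc /=; split=> /asboolP.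
rewrite horn_models_least // /horn_acc /state_at /= ffunE /=.
rewrite /bound /pos /= !subn0 add1n.
rewrite (_ : maxn 1 ((size w).+3 - 1) = (size w).+2); last by lia.
by case: (letter _ _) => [_|]; split=> /asboolPn.
Qed.
End HornToAutomaton.

Theorem theorem1 (Sigma : finType) (L : seq Sigma -> Prop) :
  RealTime_CA L <-> pred_ESO_HORN L.
Proof.
split=> [[L0 [Q [inS [acc [delta [_ H]]]]]]|[m [cls H]]].
  exists #|site_pred Q|, (ca_clauses inS acc delta) => w; split=> [Lw|[w0 hw]].
    by have w0 := L0 w Lw; split=> //; apply/ca_horn/H.
  by apply/H/ca_horn.
split=> [w /H[] //|].
exists (state cls), (@horn_input _ _ cls), (@horn_acc _ _ cls), (@horn_delta _ _ cls).
split=> [s s' [] //|w w0]; rewrite H -horn_ca //; tauto.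
Qed.
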